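(* Let $\alpha,\beta\in\overline{\mathbb{Q}_2}\setminus\{0\}$ satisfy $\gcd\left(6,e(\mathbb{Q}_2(\tfrac{\alpha}{\beta})\,|\,\mathbb{Q}_2)\right)=1$, $\left|\frac{\alpha}{\beta}\right|\neq1$, and $\frac{\alpha^3}{\beta^3}\notin\{-8,-\frac18\}$. Then $T(\alpha)\cap T(\beta)=\emptyset$. Moreover, $T(a)\cap T(-2a)=\{-a^3\}$ for all $a\in\mathbb{C}_2\setminus\{0\}$.
   Context: $\mathbb{C}_2$ is the completion of $\overline{\mathbb{Q}_2}$, with $2$-adic absolute value $|\cdot|$, $|2|=\frac12$; $e(L|\mathbb{Q}_2)$ denotes the ramification index of a finite extension $L/\mathbb{Q}_2$. For $\lambda\in\mathbb{C}_2\setminus\{0\}$, $f_\lambda(z)=\frac{z^4-8\lambda z}{4(z^3+\lambda)}$ (Lattès map of doubling on $E_\lambda:y^2=x^3+\lambda$). For $\alpha\in\mathbb{C}_2\setminus\{0\}$, $T(\alpha)=\{\lambda\in\mathbb{C}_2\setminus\{0\}:\alpha\text{ is preperiodic for }f_\lambda\}$. *)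

(* Defs.v *)
From HB Require Import structures.
From mathcomp Require Import all_boot all_order all_algebra.
From mathcomp Require Import finmap.
From mathcomp Require Import boolp classical_sets cardinality reals.

Set Implicit Arguments.
Unset Strict Implicit.
Unset Printing Implicit Defensive.

Import Order.TTheory GRing.Theory Num.Theory.
Local Open Scope classical_set_scope.
Local Open Scope ring_scope.

Section ValuedField.
Context {R : realType} {C : fieldType}.
Implicit Types (abs : C -> R) (K L : set C).

Definition algebraic_over K : set C :=
  [set x | exists p : {poly C},
    [/\ p != 0, p \is a polyOver (fun c => c \in K) & root p x]].

Definition is_subfield K : Prop := GRing.divring_closed (fun x => x \in K).

Definition adjoin K (x : C) : set C := smallest is_subfield (x |` K).

(* The completion of rat for the restriction of abs, realized as the
   topological closure of the prime field in the complete field C. *)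
Definition Q2 abs : set C :=
  [set x | forall eps : R, 0 < eps ->
    exists q : rat, abs (x - ratr q) < eps].

Definition Q2bar abs : set C := algebraic_over (Q2 abs).

(* (C, abs) is a completion of an algebraic closure of Q_2; this determines it
   up to isometric isomorphism. Together with the ultrametric inequality,
   abs2 forces C to have characteristic 0 and abs to restrict to the
   normalized 2-adic absolute value on the rationals. *)
Record is_C2 abs : Prop := IsC2 {
  abs_ge0 : forall x, 0 <= abs x;
  abs_eq0 : forall x, abs x = 0 <-> x = 0;
  absM : forall x y, abs (x * y) = abs x * abs y;
  abs_ultra : forall x y, abs (x + y) <= Num.max (abs x) (abs y);
  abs2 : abs 2 = 2^-1;
  abs_complete : forall u : nat -> C,
    (forall eps : R, 0 < eps -> exists N : nat, forall m n : nat,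
       (N <= m)%N -> (N <= n)%N -> abs (u m - u n) < eps) ->
    exists l : C, forall eps : R, 0 < eps -> exists N : nat, forall n : nat,
       (N <= n)%N -> abs (u n - l) < eps;
  Q2bar_closed : forall p : {poly C},
    p \is a polyOver (fun c => c \in Q2bar abs) -> (1 < size p)%N ->
    exists2 x, Q2bar abs x & root p x;
  Q2bar_dense : forall (x : C) (eps : R), 0 < eps ->
    exists2 y, Q2bar abs y & abs (x - y) < eps }.

Definition value_group abs L : set R := [set abs x | x in L `\ 0].

(* The index of the value group of K in that of L, as the number of cosets;
   fset_set sends an infinite set to the empty one, so the value is 0 when
   the index is infinite. *)
Definition ramification_index abs L K : nat :=
  #|` fset_set [set [set g * h | h in value_group abs K]
                 | g in value_group abs L] |%fset.

End ValuedField.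

Section Lattes.
Context {C : fieldType}.

(* option C is the projective line over C, with None the point at infinity.
   Numerator and denominator have no common zero when lambda != 0 and 3 != 0
   in C, and the numerator has the larger degree, so infinity is fixed. *)
Definition lattes (lambda : C) (P : option C) : option C :=
  if P is Some z then
    if z ^+ 3 + lambda == 0 then None
    else Some ((z ^+ 4 - 8 * lambda * z) / (4 * (z ^+ 3 + lambda)))
  else None.

Definition preperiodic (X : Type) (f : X -> X) (x : X) : Prop :=
  exists m n : nat, (m < n)%N /\ iter m f x = iter n f x.

Definition T (alpha : C) : set C :=
  [set lambda | lambda != 0 /\ preperiodic (lattes lambda) (Some alpha)].

End Lattes.

(* Main.v *)
(* In the coordinate t = z^3 / lambda the map f_lambda becomes
   t |-> t (t - 8)^3 / (64 (t + 1)^3).  Orbits with |t| > 1 escape to infinity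
   and those with 0 < |t| < 1/8 are attracted to 0; on |t| = 1 only t = -1 and
   on |t| = 1/8 only t = 8 avoid these two regions.  In between,
   4|t| |-> (4|t|)^4, so a preperiodic t has |t|^(4^k) in 2^Z for some k.
   If alpha and beta are preperiodic for the same lambda, then |alpha/beta|
   raised to some 3 * 4^k lies in 2^Z, and so does its e-th power because
   |Q_2^*| = 2^Z has index e in the value group of Q_2(alpha/beta).  Since e is
   prime to 6, |alpha/beta| itself is in 2^Z; as its cube lies between 1/8 and
   8, it is 1, 2 or 1/2, and the last two cases force
   {alpha^3 / lambda, beta^3 / lambda} = {-1, 8}. *)

Require Import Defs.
From HB Require Import structures.
From mathcomp Require Import all_boot all_order all_algebra.
From mathcomp Require Import finmap.
From mathcomp Require Import boolp classical_sets cardinality reals.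
From mathcomp Require Import ring lra.

Set Implicit Arguments.
Unset Strict Implicit.
Unset Printing Implicit Defensive.

Import Order.TTheory GRing.Theory Num.Theory.
Local Open Scope classical_set_scope.
Local Open Scope ring_scope.

(** * Preperiodic points of an arbitrary self-map *)

Section Preperiodic.
Context {X : Type} (f : X -> X).

Lemma preperiodic_image x : preperiodic f x -> preperiodic f (f x).
Proof.
by move=> [m [n [mn e]]]; exists m, n; split=> //; rewrite -!iterSr !iterS e.
Qed.

(** Serves to exclude the escaping region and the basin of 0: a quantity growing strictly along an
    orbit never repeats. *)
Lemma not_preperiodic_increasing {R : realType} (P : X -> Prop) (h : X -> R) :
  (forall x, P x -> P (f x) /\ h x < h (f x)) ->
  forall x, P x -> ~ preperiodic f x.
Proof.
move=> Pf x Px [m [n [mn e]]].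
have Pi i : P (iter i f x) by elim: i => //= i /Pf[].
suff : h (iter m f x) < h (iter n f x) by rewrite e ltxx.
elim: n mn {e} => // n IH; rewrite ltnS leq_eqVlt => /orP[/eqP<-|/IH lt].
  by case: (Pf _ (Pi m)).
by apply: lt_trans lt _; case: (Pf _ (Pi n)).
Qed.

End Preperiodic.

(** * The 2-adic absolute value and the value group of Q_2 *)

Section AbsoluteValue.
Context {R : realType} {C : fieldType} {abs : C -> R} (hC : is_C2 abs).

Lemma abs_gt0 x : (0 < abs x) = (x != 0).
Proof.
rewrite lt_def (abs_ge0 hC) andbT; congr negb.
by apply/eqP/eqP => /(abs_eq0 hC).
Qed.

Lemma abs0 : abs 0 = 0. Proof. exact/(abs_eq0 hC). Qed.

Lemma abs1 : abs 1 = 1.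
Proof.
have n0 : abs 1 != 0 by rewrite gt_eqF // abs_gt0 oner_neq0.
by apply: (mulfI n0); rewrite -(absM hC) !mulr1.
Qed.

Lemma absX x n : abs (x ^+ n) = abs x ^+ n.
Proof. by elim: n => [|n IH]; rewrite ?expr0 ?abs1 // !exprS (absM hC) IH. Qed.

Lemma absN x : abs (- x) = abs x.
Proof.
have : abs (- x) ^+ 2 = abs x ^+ 2 by rewrite -!absX sqrrN.
by move/eqP; rewrite eqrXn2 ?(abs_ge0 hC) // => /eqP.
Qed.

Lemma absV x : abs x^-1 = (abs x)^-1.
Proof.
have [->|x0] := eqVneq x 0; first by rewrite invr0 abs0 invr0.
apply: (mulfI (x := abs x)); first by rewrite gt_eqF // abs_gt0.
by rewrite -(absM hC) !mulfV ?abs1 // gt_eqF // abs_gt0.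
Qed.

Lemma abs_div x y : abs (x / y) = abs x / abs y.
Proof. by rewrite (absM hC) absV. Qed.

(** The lower bound is the ultrametric inequality for x = (x + y) - y, where y is too small to reach
    the maximum. *)
Lemma abs_add_dominant x y : abs y < abs x -> abs (x + y) = abs x.
Proof.
move=> lt; apply/le_anti/andP; split.
  by have := abs_ultra hC x y; rewrite (max_idPl (ltW lt)).
have := abs_ultra hC (x + y) (- y); rewrite addrK absN.
by rewrite le_max => /orP[//|]; rewrite leNgt lt.
Qed.

Lemma abs_pow2 n : abs (2 ^ n)%:R = 2^-1 ^+ n.
Proof. by rewrite natrX absX (abs2 hC). Qed.

Lemma abs8 : abs 8 = 8^-1.
Proof. by rewrite -[8]/((2 ^ 3)%:R) abs_pow2; field. Qed.

Lemma abs64 : abs 64 = 64^-1.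
Proof. by rewrite -[64]/((2 ^ 6)%:R) abs_pow2; field. Qed.

Lemma two_neq0 : (2 : C) != 0.
Proof. by rewrite -abs_gt0 (abs2 hC) invr_gt0 ltr0n. Qed.

Lemma abs_nat_le1 n : abs n%:R <= 1.
Proof.
elim: n => [|n IH]; first by rewrite abs0.
by rewrite -natr1 (le_trans (abs_ultra hC _ _)) // ge_max IH abs1 lexx.
Qed.

Lemma abs_odd n : odd n -> abs n%:R = 1.
Proof.
move=> on; rewrite -(odd_double_half n) on -mul2n natrD natrM abs_add_dominant abs1 //.
rewrite (absM hC) (abs2 hC); have := abs_nat_le1 n./2; lra.
Qed.

(** The exponent is the 2-adic valuation: the odd part of n has absolute value 1. *)
Lemma abs_int_neq0 (n : int) : n != 0 -> exists k : nat, abs n%:~R = 2 ^- k.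
Proof.
have absnat m : (0 < m)%N -> exists k : nat, abs m%:R = 2 ^- k.
  move=> m0; exists (logn 2 m); rewrite -exprVn -abs_pow2 -p_part.
  rewrite -{1}(partnC 2%N m0) natrM (absM hC) [X in _ * X]abs_odd ?mulr1 //.
  by rewrite odd_2'nat part_pnat.
case: (intP n) => // m _; first exact: absnat.
by rewrite rmorphN /= absN; apply: absnat.
Qed.

Lemma intr_neq0_C2 (n : int) : n != 0 -> n%:~R != 0 :> C.
Proof.
move=> /abs_int_neq0[k e]; rewrite -abs_gt0 e invr_gt0 exprn_gt0 //.
Qed.

(** [ratr] is the quotient of the images of [numq] and [denq], so the integer identity
    [numq q * n = denq q] is carried over to [C], where nonzero integers stay nonzero. *)
Lemma ratr_natV n : (0 < n)%N -> ratr (n%:R^-1 : rat) = n%:R^-1 :> C.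
Proof.
move=> n0; have n0C : n%:R != 0 :> C by apply: (@intr_neq0_C2 n); rewrite eqz_nat -lt0n.
set q : rat := n%:R^-1.
have n0q : n%:R != 0 :> rat.
  by rewrite pnatr_eq0 -lt0n.
have dq : (denq q)%:~R != 0 :> rat by rewrite intr_eq0 denq_neq0.
have : numq q * n%:Z = denq q.
  apply: (@intr_inj rat); rewrite rmorphM /=.
  have := divq_num_den q; rewrite {3}/q => /(canRL (divfK dq)) ->.
  by rewrite mulrAC mulVf // mul1r.
move=> /(congr1 (fun m : int => m%:~R : C)); rewrite rmorphM /= => e.
apply: (mulIf n0C); rewrite mulVf //.
by rewrite /ratr mulrAC e divff // intr_neq0_C2 // denq_neq0.
Qed.

(** Passing to the closure adds no values: a rational closer to x than |x| has the same absolute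
    value as x. *)
Lemma value_group_Q2 : value_group abs (Q2 abs) = range (fun k : int => 2 ^ k).
Proof.
apply/seteqP; split=> [_ [x [Qx /eqP x0] <-]|_ [k _ <-]].
  have ax : 0 < abs x by rewrite abs_gt0.
  have [q lt] := Qx _ ax.
  have eq : abs (ratr q) = abs x.
    have -> : ratr q = x + (ratr q - x) by ring.
    by rewrite abs_add_dominant // -absN opprB.
  have q0 : q != 0.
    by apply: contraTN ax => /eqP q0; rewrite -eq q0 (ratr_nat _ 0) abs0 ltxx.
  have [m em] : exists k : nat, abs (numq q)%:~R = 2 ^- k.
    by apply: abs_int_neq0; rewrite numq_eq0.
  have [n en] := abs_int_neq0 (denq_neq0 q).
  exists (n%:Z - m%:Z) => //=.
  by rewrite -eq /ratr abs_div em en invrK exprnN expfzDr ?pnatr_eq0 // mulrC.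
have Q2rat q a : 0 < a -> abs (ratr q) = a -> value_group abs (Q2 abs) a.
  move=> a0 qa; exists (ratr q) => //; split; last first.
    by move=> /= r0; move: a0; rewrite -qa r0 abs0 ltxx.
  by move=> eps eps0; exists q; rewrite subrr abs0.
(* Since |2| = 1/2, nonnegative powers of 2 are values of inverse powers of 2, and conversely. *)
case: k => n.
  apply: (Q2rat (2 ^ n)%:R^-1); first by rewrite exprz_gt0.
  by rewrite ratr_natV ?absV ?abs_pow2 ?exprVn ?invrK // expn_gt0.
apply: (Q2rat (2 ^ n.+1)%:R); first by rewrite exprz_gt0.
by rewrite ratr_nat abs_pow2 NegzE -exprnN exprVn.
Qed.

End AbsoluteValue.

(* Lagrange for cosets: multiplication by g permutes them, so the product of
   the ratios g a_X / a_(gX) over coset representatives a_X is g ^+ n. *)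
Lemma exp_coset_index {F : fieldType} (G H : set F) :
  ~ G 0 -> ~ H 0 -> H 1 ->
  (forall x y, G x -> G y -> G (x * y)) ->
  (forall x y, H x -> H y -> H (x / y)) ->
  forall n, n = #|` fset_set [set [set g * h | h in H] | g in G]|%fset ->
  (0 < n)%N -> forall g, G g -> H (g ^+ n).
Proof.
move=> G0 H0 H1 GM HV n; set S := (X in fset_set X) => nE n0 g Gg.
(* [fset_set] sends an infinite set to the empty one, which would give n = 0. *)
have fS : finite_set S.
  apply: contrapT => iS; move: n0; rewrite nE /fset_set.
  by case: pselect.
have HM x y : H x -> H y -> H (x * y).
  by move=> Hx Hy; rewrite -[y]invrK; apply: (HV) => //; rewrite -div1r; apply: HV.
have [a aP] : exists a : set F -> F, forall X, S X ->
    G (a X) /\ X = [set a X * h | h in H].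
  have /choice[a aP] : forall X, exists b, S X -> G b /\ X = [set b * h | h in H].
    move=> X; have [[b Gb <-]|nS] := pselect (S X); first by exists b.
    by exists 0.
  by exists a.
have g0 : g != 0 by apply/eqP => g0; apply: G0; rewrite -g0.
pose t (X : set F) : set F := [set g * x | x in X].
have tS X : S X -> S (t X).
  move=> [b Gb <-]; exists (g * b); first exact: GM.
  apply/seteqP; split=> [_ [h Hh <-]|_ [_ [h Hh <-] <-]] /=.
    by exists (b * h); [exists h | rewrite mulrA].
  by exists h; rewrite ?mulrA.
have tI : injective t.
  apply: (can_inj (g := fun X => [set g^-1 * x | x in X])) => X.
  apply/seteqP; split=> [_ [_ [x Xx <-] <-]|x Xx]; rewrite /= ?mulKf //.
  by exists (g * x); [exists x | rewrite mulKf].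
(* As 1 lies in [H], the element [g * a X] lies in the coset [t X], hence in [a (t X)] times [H]. *)
have aS X : S X -> H (g * a X / a (t X)).
  move=> SX; have [GaX eX] := aP _ SX; have [Gat et] := aP _ (tS _ SX).
  have : t X (g * a X).
    by exists (a X) => //; rewrite eX; exists 1; rewrite // -eX mulr1.
  rewrite {1}et => -[h Hh <-]; rewrite mulrAC divff ?mul1r //.
  by apply/eqP => z; apply: G0; rewrite -z.
have a0 X : S X -> a X != 0.
  by move=> /aP[Ga _]; apply/eqP => z; apply: G0; rewrite -z.
pose r : seq (set F) := fset_set S.
have rS X : X \in r -> S X by rewrite /r in_fset_set // inE.
have perm : perm_eq [seq t X | X <- r] r.
  have ut : uniq [seq t X | X <- r] by rewrite (map_inj_uniq tI) fset_uniq.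
  have [||_ e] := uniq_min_size (s1 := [seq t X | X <- r]) (s2 := r) ut.
  - by move=> _ /mapP[X /rS /tS St ->]; rewrite /r in_fset_set // inE.
  - by rewrite size_map.
  by apply: uniq_perm => //; apply: fset_uniq.
have : H (\prod_(X <- r) (g * a X / a (t X))).
  rewrite big_seq; elim/big_ind : _ => // X /rS; exact: aS.
rewrite big_split /= prodfV -(big_map t predT a) (perm_big _ perm) big_split /=.
rewrite mulfK; last first.
  by rewrite prodf_seq_neq0; apply/allP => X /rS /a0.
by rewrite big_const_seq count_predT iter_mulr_1 nE.
Qed.

#[local] Arguments lattes : simpl never.

(** * Size of t = z^3 / lambda along orbits of the Lattès map *)

Section LattesOrbits.
Context {R : realType} {C : fieldType} {abs : C -> R} (hC : is_C2 abs).
Context {lambda : C} (lambda0 : lambda != 0).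

Local Notation f := (lattes lambda).
Local Notation t z := (z ^+ 3 / lambda).
Local Notation N z := (abs (t z)).

Lemma N_gt0 z : (0 < N z) = (z != 0).
Proof.
by rewrite (abs_gt0 hC) mulf_eq0 expf_eq0 invr_eq0 (negPf lambda0) orbF.
Qed.

Lemma lattes_pole z : t z = -1 -> f (Some z) = None.
Proof.
move=> tz; have e : z ^+ 3 = - lambda.
  by rewrite -[LHS](divfK lambda0) tz mulN1r.
by rewrite /lattes e addNr eqxx.
Qed.

Lemma lattes_t z : t z != -1 ->
  exists2 y, f (Some z) = Some y &
    t y = t z * (t z - 8) ^+ 3 / (64 * (t z + 1) ^+ 3).
Proof.
move=> tz.
have z1 : z ^+ 3 + lambda != 0.
  apply: contraNneq tz => /eqP; rewrite addr_eq0 => /eqP->.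
  by rewrite mulNr divff.
rewrite /lattes (negPf z1); eexists; first reflexivity.
have two0 := two_neq0 hC.
have n64 : (64 : C) != 0 by rewrite -(abs_gt0 hC) (abs64 hC); lra.
have n4 : (4 : C) != 0 by rewrite (_ : 4 = 2 * 2) ?mulf_neq0 //; ring.
by field; apply/and4P; split.
Qed.

Lemma N_lattes z : t z != -1 ->
  exists2 y, f (Some z) = Some y &
    N y = 64 * N z * abs (t z - 8) ^+ 3 / abs (t z + 1) ^+ 3.
Proof.
move=> tz; have [y fy ty] := lattes_t tz; exists y => //; rewrite ty.
rewrite (abs_div hC (_ * _)) (absM hC (t z)) (absM hC 64) !(absX hC (_ + _)) (abs64 hC).
by field; rewrite gt_eqF // (abs_gt0 hC) addr_eq0.
Qed.

(** Here |t - 8| = |t + 1| = |t|, so the cubes cancel and 1 / |64| = 64 remains. *)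
Lemma N_lattes_gt1 z : 1 < N z -> exists2 y, f (Some z) = Some y & N y = 64 * N z.
Proof.
move=> N1; have [|y fy Ny] := @N_lattes z.
  by apply: contraTneq N1 => ->; rewrite (absN hC) (abs1 hC) ltxx.
exists y => //; rewrite Ny !(abs_add_dominant hC) ?(absN hC) ?(abs1 hC) ?(abs8 hC); last by lra.
  by rewrite mulfK // expf_neq0 // gt_eqF //; lra.
done.
Qed.

Lemma N_lattes_lt1 z : N z < 1 ->
  exists2 y, f (Some z) = Some y & N y = 64 * N z * abs (t z - 8) ^+ 3.
Proof.
move=> N1; have [|y fy Ny] := @N_lattes z.
  by apply: contraTneq N1 => ->; rewrite (absN hC) (abs1 hC) ltxx.
exists y => //; rewrite Ny [t z + 1]addrC (abs_add_dominant hC (x := 1)) (abs1 hC) //.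
by rewrite expr1n divr1.
Qed.

Lemma preperiodic_le1 z : preperiodic f (Some z) -> N z <= 1.
Proof.
move=> pz; rewrite leNgt; apply/negP => N1; move: pz.
(* The value 0 at infinity keeps this fixed point out of the region 1 < h. *)
pose h (x : option C) := if x is Some y then N y else 0.
apply: (not_preperiodic_increasing (P := fun x => 1 < h x) (h := h)) => //.
case=> [y|] /=; last by rewrite ltr10.
by move=> Ny; have [w fw Nw] := N_lattes_gt1 Ny; rewrite fw /= Nw; split; lra.
Qed.

Lemma preperiodic_ge z : preperiodic f (Some z) -> z != 0 -> 8^-1 <= N z.
Proof.
move=> pz; rewrite -N_gt0 leNgt => N0; apply/negP => N1; move: pz.
pose h (x : option C) := if x is Some y then N y else 0.
apply: (not_preperiodic_increasing
  (P := fun x => 0 < h x < 8^-1) (h := fun x => - h x)); last by rewrite /= N0.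
case=> [y|] /= /andP[y0 y8]; last by rewrite ltxx in y0.
have [|w fw Nw] := @N_lattes_lt1 y; first lra.
(* Now |t - 8| = 1/8, so |t| is multiplied by 64 / 8^3 = 1/8. *)
move: Nw; rewrite addrC (abs_add_dominant hC) (absN hC) (abs8 hC) // => Nw.
by rewrite fw /= Nw; split; lra.
Qed.

(** If t differs from -1, then |t - 8| = 1 and |t + 1| <= 1, so the image has |t| >= 64 and
    escapes. *)
Lemma preperiodic_eq1 z : preperiodic f (Some z) -> N z = 1 -> z ^+ 3 = - lambda.
Proof.
move=> pz N1; have [tz|tz] := eqVneq (t z) (-1).
  by rewrite -[LHS](divfK lambda0) tz mulN1r.
have [y fy Ny] := N_lattes tz.
have := preperiodic_image pz; rewrite fy => /preperiodic_le1; rewrite Ny N1.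
rewrite (abs_add_dominant hC (y := - 8)) ?(absN hC) ?(abs8 hC) N1 //; last lra.
have a0 : 0 < abs (t z + 1) by rewrite (abs_gt0 hC) addr_eq0.
have := abs_ultra hC (t z) 1; rewrite N1 (abs1 hC) maxxx => a1.
rewrite ler_pdivrMr ?exprn_gt0 // => l.
have : abs (t z + 1) ^+ 3 <= 1 by rewrite exprn_ile1 // ltW.
by move=> a3; suff : (1 : R) < 0 by [rewrite ltr10]; lra.
Qed.

(** If t differs from 8, then 0 < |t - 8| <= 1/8, so the image has 0 < |t| <= 1/64 and falls into
    the basin of 0. *)
Lemma preperiodic_eq8V z : preperiodic f (Some z) -> N z = 8^-1 -> z ^+ 3 = 8 * lambda.
Proof.
move=> pz N8; have [tz|tz] := eqVneq (t z) 8.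
  by rewrite -[LHS](divfK lambda0) tz.
have [|y fy Ny] := @N_lattes_lt1 z; first by lra.
have a0 : 0 < abs (t z - 8) by rewrite (abs_gt0 hC) subr_eq0.
have := abs_ultra hC (t z) (- 8); rewrite N8 (absN hC) (abs8 hC) maxxx => a1.
have a3 : abs (t z - 8) ^+ 3 <= 8^-1 ^+ 3 by rewrite lerXn2r // ?nnegrE ?ltW //; lra.
have := preperiodic_image pz; rewrite fy => /preperiodic_ge py.
have : 0 < abs (t z - 8) ^+ 3 by rewrite exprn_gt0.
have y0 : y != 0.
  by rewrite -N_gt0 Ny N8 pmulr_rgt0 ?exprn_gt0 //; lra.
move: (py y0); rewrite Ny N8 => y8.
by suff : (1 : R) < 0 by [rewrite ltr10]; lra.
Qed.

(** The first alternative records an orbit that meets |t| = 1 or |t| = 1/8. Strictly between these,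
    |t - 8| = |t| and |t + 1| = 1, so the image has size 64 |t|^4, that is, 4|t| is raised to the
    fourth power. *)
Lemma preperiodic_iter z n : preperiodic f (Some z) -> z != 0 ->
  (exists k, (4 * N z) ^+ (4 ^ k) = 4 \/ (4 * N z) ^+ (4 ^ k) = 2^-1) \/
  exists y, [/\ iter n f (Some z) = Some y, preperiodic f (Some y), y != 0 &
                4 * N y = (4 * N z) ^+ (4 ^ n)].
Proof.
move=> pz z0; elim: n => [|n [|[y [fy py y0 Ny]]]].
- by right; exists z; split; rewrite // expn0 expr1.
- by left.
have [y1|y1] := eqVneq (N y) 1; first by left; exists n; left; rewrite -Ny y1 mulr1.
have [y8|y8] := eqVneq (N y) 8^-1.
  by left; exists n; right; rewrite -Ny y8; lra.
have lt1 : N y < 1 by rewrite lt_neqAle y1 preperiodic_le1.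
have gt8 : 8^-1 < N y by rewrite lt_neqAle eq_sym y8 preperiodic_ge.
have [w fw Nw] := N_lattes_lt1 lt1.
move: Nw; rewrite (abs_add_dominant hC) ?(absN hC) ?(abs8 hC) // => Nw.
right; exists w; split.
- by rewrite iterS fy.
- by rewrite -fw; apply: preperiodic_image.
- by rewrite -N_gt0 Nw mulr_gt0 ?exprn_gt0 //; lra.
by rewrite expnSr exprM -Ny Nw; ring.
Qed.

Lemma preperiodic_abs_pow2 z : preperiodic f (Some z) -> z != 0 ->
  exists (k : nat) (j : int), N z ^+ (4 ^ k) = 2 ^ j.
Proof.
move=> pz z0.
suff [k [j e]] : exists (k : nat) (j : int), (4 * N z) ^+ (4 ^ k) = 2 ^ j.
  exists k, (j - (2 * 4 ^ k)%N%:Z).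
  rewrite expfzDr ?pnatr_eq0 // -exprnN exprM -e exprMn.
  rewrite (_ : 2 ^+ 2 = 4 :> R); last by ring.
  by rewrite [_ * N z ^+ _]mulrC mulfK // expf_neq0 // pnatr_eq0.
have [m [n [mn emn]]] := pz.
have [[k [e|e]]|[y [ym _ _ Ny]]] := preperiodic_iter m pz z0.
- by exists k, 2; rewrite e; ring.
- by exists k, (-1).
have [[k [e|e]]|[y' [yn _ _ Ny']]] := preperiodic_iter n pz z0.
- by exists k, 2; rewrite e; ring.
- by exists k, (-1).
have w0 : 0 < 4 * N z by rewrite mulr_gt0 // N_gt0.
(* The m-th and n-th iterates coincide, so 4|t| has equal powers with distinct exponents 4^m and
   4^n; being positive, it is 1. *)
exists 0, 0; rewrite expn0 expr1 expr0z.
have e : (4 * N z) ^+ (4 ^ m) = (4 * N z) ^+ (4 ^ n).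
  by rewrite -Ny -Ny'; move: yn; rewrite -emn ym => -[->].
apply/eqP; apply: contraTT mn => w1.
move: e => /(ieexprIn w0 w1) /eqP; rewrite eqn_exp2l // => /eqP->.
by rewrite ltnn.
Qed.

End LattesOrbits.

(** * Ramification index and powers of 2 *)

Lemma smallest_subfield {C : fieldType} (A : set C) :
  is_subfield (smallest is_subfield A).
Proof.
split; first by rewrite inE => M [[M1 _ _] _]; rewrite -in_setE.
  move=> x y; rewrite !inE => Sx Sy M hM; have [[_ MB _] _] := hM.
  by rewrite -in_setE; apply: MB; rewrite in_setE; [apply: Sx | apply: Sy].
move=> x y; rewrite !inE => Sx Sy M hM; have [[_ _ MV] _] := hM.
by rewrite -in_setE; apply: MV; rewrite in_setE; [apply: Sx | apply: Sy].
Qed.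

Section Ramification.
Context {R : realType} {C : fieldType} {abs : C -> R} (hC : is_C2 abs).

Lemma value_groupM (L : set C) (a b : R) : is_subfield L ->
  value_group abs L a -> value_group abs L b -> value_group abs L (a * b).
Proof.
move=> [L1 _ LV] [x [Lx /eqP x0] <-] [y [Ly /eqP y0] <-].
exists (x * y); last exact: absM.
split; last by apply/eqP; rewrite mulf_neq0.
rewrite -[y]invrK -in_setE; apply: (LV); rewrite ?in_setE //.
by rewrite -div1r -in_setE; apply: LV => //; rewrite in_setE.
Qed.

(** The index of 2^Z in the value group of Q_2(x), when finite, annihilates the quotient group. *)
Lemma abs_exp_ramification_index x : x != 0 ->
  let e := ramification_index abs (adjoin (Q2 abs) x) (Q2 abs) in
  (0 < e)%N -> exists j : int, abs x ^+ e = 2 ^ j.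
Proof.
move=> x0 e e0.
suff : value_group abs (Q2 abs) (abs x ^+ e).
  by rewrite (value_group_Q2 hC) => -[j _ <-]; exists j.
apply: (exp_coset_index (G := value_group abs (adjoin (Q2 abs) x))) e0 _ _ => //.
- by move=> [y [_ y0] /(abs_eq0 hC)].
- by move=> [y [_ y0] /(abs_eq0 hC)].
- by rewrite (value_group_Q2 hC); exists 0.
- by move=> a b; apply: value_groupM; apply: smallest_subfield.
- rewrite (value_group_Q2 hC) => _ _ [i _ <-] [j _ <-].
  by exists (i - j); rewrite // expfzDr ?pnatr_eq0 // -invr_expz.
exists x => //; split; last exact/eqP.
by move=> M [_]; apply; left.
Qed.

End Ramification.

(** With Bezout coefficients u a + v b = 1, x = (x^a)^u (x^b)^v. *)
Lemma pow2_of_coprime_exp {R : realType} (x : R) (a b : nat) (i j : int) :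
  0 < x -> coprime a b -> x ^+ a = 2 ^ i -> x ^+ b = 2 ^ j ->
  exists l : int, x = 2 ^ l.
Proof.
move=> x0 cab ai bj; have [u [v uv]] := Bezoutz a b.
have {uv} uv : u * a%:Z + v * b%:Z = 1.
  by rewrite uv /gcdz /= (eqP cab).
exists (i * u + j * v).
rewrite expfzDr ?pnatr_eq0 // -!exprz_exp -ai -bj.
by rewrite !exprnP !exprz_exp -expfzDr ?gt_eqF // mulrC [b%:Z * v]mulrC uv expr1z.
Qed.

(** * Two points preperiodic for the same lambda *)

Section SimultaneousTorsion.
Context {R : realType} {C : fieldType} {abs : C -> R} (hC : is_C2 abs).

(** Both sizes |t| lie in [1/8, 1], so a ratio of 8 puts them at the two endpoints, where t is
    known. *)
Lemma T_eq1_eq8V (lambda a b : C) : a != 0 -> b != 0 ->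
  T a lambda -> T b lambda -> abs (a ^+ 3 / b ^+ 3) = 8 ->
  a ^+ 3 = - lambda /\ b ^+ 3 = 8 * lambda.
Proof.
move=> a0 b0 [l0 pa] [_ pb] ab8.
have Na1 := preperiodic_le1 hC l0 pa.
have Nb8 := preperiodic_ge hC l0 pb b0.
have Nab : abs (a ^+ 3 / lambda) = 8 * abs (b ^+ 3 / lambda).
  rewrite -ab8 -(absM hC); congr abs; rewrite mulrA divfK // expf_neq0 //.
split.
  by apply: (preperiodic_eq1 hC l0 pa); apply/le_anti; rewrite Na1 /=; lra.
apply: (preperiodic_eq8V hC l0 pb); apply/le_anti; rewrite Nb8 andbT; lra.
Qed.

(** In the quotient of the two values of t, lambda cancels and leaves (a / b)^3; raised to 4^(m +
    n), its absolute value is a power of 2. The exponent 3 * 4^(m + n) is coprime to e. *)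
Lemma T_ratio_pow2 (lambda a b : C) (e : nat) (i : int) : a != 0 -> b != 0 ->
  T a lambda -> T b lambda -> coprime 6 e -> abs (a / b) ^+ e = 2 ^ i ->
  exists l : int, abs (a / b) = 2 ^ l.
Proof.
move=> a0 b0 [l0 pa] [_ pb] ce abe.
have [m [j ja]] := preperiodic_abs_pow2 hC l0 pa a0.
have [n [k kb]] := preperiodic_abs_pow2 hC l0 pb b0.
have ab0 : 0 < abs (a / b) by rewrite (abs_gt0 hC) mulf_neq0 ?invr_eq0.
apply: (pow2_of_coprime_exp (a := e) (b := 3 * 4 ^ (m + n))
  (j := j * (4 ^ n)%N%:Z - k * (4 ^ m)%N%:Z)) ab0 _ abe _.
  move: ce; rewrite -[6%N]/(2 * 3)%N coprimeMl => /andP[c2 c3].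
  by rewrite coprimeMr coprime_sym c3 coprimeXr // -[4%N]/(2 ^ 2)%N coprimeXr // coprime_sym.
have -> : abs (a / b) ^+ (3 * 4 ^ (m + n)) =
    (2 ^ j) ^+ (4 ^ n) / (2 ^ k) ^+ (4 ^ m).
  rewrite exprM -(absX hC) -ja -kb -!exprM -!expnD [(n + m)%N]addnC -expr_div_n.
  rewrite -(abs_div hC).
  rewrite (_ : (a / b) ^+ 3 = a ^+ 3 / lambda / (b ^+ 3 / lambda)) //.
  by field; rewrite l0 b0.
by rewrite expfzDr ?pnatr_eq0 // -invr_expz -!exprz_exp.
Qed.

Lemma T_cube_ratio (lambda a b : C) (e : nat) (i : int) : a != 0 -> b != 0 ->
  T a lambda -> T b lambda -> coprime 6 e -> abs (a / b) ^+ e = 2 ^ i ->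
  1 < abs (a / b) -> a ^+ 3 / b ^+ 3 = - (1 / 8).
Proof.
move=> a0 b0 Ta Tb ce abe ab1; have [l0 pa] := Ta; have [_ pb] := Tb.
have [l al] := T_ratio_pow2 a0 b0 Ta Tb ce abe.
have Na1 := preperiodic_le1 hC l0 pa.
have Nb8 := preperiodic_ge hC l0 pb b0.
have ab3 : abs (a / b) ^+ 3 <= 2 ^+ 3.
  rewrite -(absX hC) expr_div_n.
  have -> : a ^+ 3 / b ^+ 3 = (a ^+ 3 / lambda) / (b ^+ 3 / lambda).
    by field; rewrite l0 b0.
  rewrite (abs_div hC) ler_pdivrMr; lra.
have ab2 : abs (a / b) <= 2.
  by rewrite -(@ler_pXn2r _ 3) // ?nnegrE // ltW // (lt_trans _ ab1).
(* From 1 < 2^l <= 2. *)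
have l1 : l = 1.
  have : 2 ^ (0 : int) < (2 : R) ^ l by rewrite -al.
  rewrite ltr_eXz2l ?ltr1n // gtz0_ge1 => l1.
  have : (2 : R) ^ l <= 2 ^ (1 : int) by rewrite -al.
  rewrite ler_eXz2l ?ltr1n // => l2.
  by apply/le_anti; rewrite l1 l2.
have [|ea eb] := T_eq1_eq8V a0 b0 Ta Tb.
  rewrite -expr_div_n (absX hC) al l1; ring.
rewrite ea eb; field.
by rewrite l0 andbT -(abs_gt0 hC) (abs8 hC); lra.
Qed.

End SimultaneousTorsion.

(** * Disjointness, and the exceptional pair a, -2a *)

Theorem theorem2p17 (R : realType) (C : fieldType) (abs : C -> R)
    (hC : is_C2 abs) :
  (forall alpha beta : C,
     Q2bar abs alpha -> alpha != 0 ->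
     Q2bar abs beta -> beta != 0 ->
     gcdn 6 (ramification_index abs (adjoin (Q2 abs) (alpha / beta))
               (Q2 abs)) = 1%N ->
     abs (alpha / beta) <> 1 ->
     alpha ^+ 3 / beta ^+ 3 <> - 8 ->
     alpha ^+ 3 / beta ^+ 3 <> - (1 / 8) ->
     T alpha `&` T beta = set0) /\
  (forall a : C, a != 0 -> T a `&` T (- 2 * a) = [set - a ^+ 3]).
Proof.
have two0 := two_neq0 hC.
have eight0 : (8 : C) != 0 by rewrite -(abs_gt0 hC) (abs8 hC); lra.
split=> [alpha beta _ a0 _ b0 ce ab1 ab8 ab8V|a a0]; apply/seteqP; split=> lambda //.
- case=> Ta Tb.
  have ab0 : alpha / beta != 0 by rewrite mulf_neq0 ?invr_eq0.
  (* An infinite index is encoded as 0, which is excluded because gcd(6, 0) = 6. *)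
  have [|i ei] := abs_exp_ramification_index hC ab0 => //.
    by rewrite lt0n; apply: contra_eq_neq ce => ->.
  have [lt|gt|//] := ltgtP (abs (alpha / beta)) 1.
    (* When |alpha / beta| < 1 the roles are exchanged, and -1/8 becomes its inverse -8. *)
    apply: ab8.
    have -> : alpha ^+ 3 / beta ^+ 3 = (beta ^+ 3 / alpha ^+ 3)^-1 by rewrite invf_div.
    have eV : abs (beta / alpha) = (abs (alpha / beta))^-1.
      by rewrite -(absV hC) invf_div.
    rewrite (T_cube_ratio (i := - i) hC b0 a0 Tb Ta (introT eqP ce)) ?eV.
    + by rewrite div1r invrN invrK.
    + by rewrite exprVn ei invr_expz.
    + by rewrite invf_gt1 // (abs_gt0 hC).
  by apply: ab8V; apply: (T_cube_ratio hC a0 b0 Ta Tb (introT eqP ce) ei).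
- case=> Ta Tb.
  have b0 : - 2 * a != 0 by rewrite mulf_neq0 ?oppr_eq0.
  have [|ea _] := T_eq1_eq8V hC a0 b0 Ta Tb; last by rewrite /= ea opprK.
  rewrite (_ : a ^+ 3 / (- 2 * a) ^+ 3 = - 8^-1); last by field; rewrite eight0 a0 oppr_eq0.
  by rewrite (absN hC) (absV hC) (abs8 hC) invrK.
move=> ->.
have l0 : - a ^+ 3 != 0 by rewrite oppr_eq0 expf_neq0.
split; split=> //.
  (* For lambda = -a^3 the point a has t = -1, a pole, so it reaches the fixed point at infinity
     after one step. *)
  exists 1, 2; split=> //=.
  by rewrite lattes_pole // invrN mulrN divff // expf_neq0.
exists 1, 2; split=> //=.
(* The point -2a has t = 8, a zero of the map, and 0 is fixed. *)
suff -> : lattes (- a ^+ 3) (Some (- 2 * a)) = Some 0.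
  by rewrite /lattes expr0n /= add0r (negPf l0) expr0n /= !(mulr0, mul0r, subr0).
rewrite /lattes ifN.
  by congr Some; rewrite (_ : _ - _ = 0) ?mul0r //; ring.
(* The denominator is nonzero because 9 is odd, so |9| = 1. *)
rewrite (_ : _ + _ = - 9 * a ^+ 3); last ring.
rewrite mulf_neq0 ?expf_neq0 // oppr_eq0 -(abs_gt0 hC).
by rewrite (abs_odd hC (n := 9)).
Qed.
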